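(* Let $n\ge1$, $l\ge1$ be integers, $m_1,\dots,m_l\ge2$ distinct integers, $p\in(0,1)$, $\alpha_q\ge0$ for all $q=1,\dots,l$, and $$f(X)=n\left(\sum_{q=1}^{l}\frac{\alpha_q}{n^{m_q}}\sum_{i_1\neq\dots\neq i_{m_q}}X_{i_1}\cdots X_{i_{m_q}}\right)+\log\left(\frac{p}{1-p}\right)\|X\|_1,\qquad X\in\{0,1\}^n.$$ Let $C_\alpha$, $\mathcal{X}_f$, $\varphi_\alpha$ and $D_\alpha$ be as defined in the context. Assume that the equation $x=\varphi_\alpha(x)$ has a unique solution $x\in[0,1]$ and that $D_\alpha<1$. Then for any $X\in\mathcal{X}_f$ and any $0<\varepsilon<1$, $$\|X-x\mathbf{1}_n\|_1\le\varepsilon n+10000\,C_\alpha^{2}\,\varepsilon^{\frac{\log C_\alpha}{\log D_\alpha}}\,n^{7/8}.$$ Furthermore, for any constants $C_\alpha$ and $D_\alpha$, there exist constants $c>0$ and $0<\eta<1/8$ (depending only on the values of $C_\alpha$ and $D_\alpha$) such that for any $X\in\mathcal{X}_f$, $$\|X-x\mathbf{1}_n\|_1\le c\,n^{1-\eta}.$$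
   Context: Sums over $i_1\neq\dots\neq i_m$ run over all ordered $m$-tuples of pairwise distinct indices in $[n]=\{1,\dots,n\}$. $\|\cdot\|_1$ is the $1$-norm on $\mathbb{R}^n$, $\mathbf{1}_n$ is the all-ones vector, and $\tanh$ is applied entrywise. Discrete gradient: $\nabla f(X)=(\partial_1 f(X),\dots,\partial_n f(X))$, where for $X\in\{0,1\}^n$, $\partial_j f(X)=\frac12\big(f(X_1,\dots,X_{j-1},1,X_{j+1},\dots,X_n)-f(X_1,\dots,X_{j-1},0,X_{j+1},\dots,X_n)\big)$; for $X\in[0,1]^n$ it is extended by the formula $$\partial_j f(X)=\frac12\log\left(\frac{p}{1-p}\right)+\sum_{q=1}^{l}\frac{m_q\alpha_q}{2n^{m_q-1}}C_j^{m_q}(X),\qquad C_j^{m}(X)=\sum_{j\neq i_1\neq\dots\neq i_{m-1}}X_{i_1}\cdots X_{i_{m-1}},$$ the last sum being over ordered tuples of pairwise distinct indices all different from $j$. Constants and sets: $$C_\alpha=\max\left\{2,\ \frac12\left|\log\left(\frac{p}{1-p}\right)\right|+\frac12\sum_{q=1}^{l}|\alpha_q|m_q(m_q-1)\right\},$$ $$\mathcal{X}_f=\left\{X\in[0,1]^n:\ \left\|X-\frac{\mathbf{1}_n+\tanh(\nabla f(X))}{2}\right\|_1\le 5000\,C_\alpha^2\,n^{7/8}\right\}.$$ The function $\varphi_\alpha:[0,1]\to\mathbb{R}$ is $$\varphi_\alpha(x)=\frac12\left(1+\tanh\left(\frac12\log\left(\frac{p}{1-p}\right)+\frac12\sum_{q=1}^{l}m_q\alpha_q\prod_{i=1}^{m_q-1}\left(1-\frac{i}{n}\right)x^{m_q-1}\right)\right).$$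 If $\varphi_\alpha$ has a unique fixed point $x$, then $$D_\alpha=\sup_{y\in[0,1],\,y\neq x}\frac{|\varphi_\alpha(y)-x|}{|y-x|}.$$ *)

(* Defs.v *)
From HB Require Import structures.
From mathcomp Require Import all_boot all_order all_algebra.
From mathcomp Require Import all_classical all_reals all_analysis.
From mathcomp Require Import ring.

Set Implicit Arguments.
Unset Strict Implicit.
Unset Printing Implicit Defensive.

Import Order.TTheory GRing.Theory Num.Theory.

Local Open Scope classical_set_scope.
Local Open Scope ring_scope.

Definition tanh (R : realType) (x : R) : R :=
  (expR x - expR (- x)) / (expR x + expR (- x)).

(* The library norm on row vectors is the sup norm, hence this definition. *)
Definition l1norm (R : realType) (n : nat) (X : 'rV[R]_n) : R :=
  \sum_(i < n) `|X 0 i|.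

Definition in_cube (R : realType) (n : nat) (X : 'rV[R]_n) : Prop :=
  forall i, 0 <= X 0 i <= 1.

Definition is_boolean (R : realType) (n : nat) (X : 'rV[R]_n) : bool :=
  [forall i, (X 0 i == 0) || (X 0 i == 1)].

Definition set_coord (R : realType) (n : nat) (X : 'rV[R]_n) (j : 'I_n) (a : R)
    : 'rV[R]_n :=
  \row_i (if i == j then a else X 0 i).

Definition discrete_partial (R : realType) (n : nat) (F : 'rV[R]_n -> R)
    (j : 'I_n) (X : 'rV[R]_n) : R :=
  2^-1 * (F (set_coord X j 1) - F (set_coord X j 0)).

Definition distinct_sum (R : realType) (n k : nat) (X : 'rV[R]_n) : R :=
  \sum_(t : k.-tuple 'I_n | uniq t) \prod_(i <- t) X 0 i.

Definition C_sum (R : realType) (n k : nat) (j : 'I_n) (X : 'rV[R]_n) : R :=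
  \sum_(t : k.-1.-tuple 'I_n | uniq (j :: t)) \prod_(i <- t) X 0 i.

Definition logit (R : realType) (p : R) : R := ln (p / (1 - p)).

(* Meant for X in {0,1}^n; the formula happens to make sense for all X. *)
Definition hamiltonian (R : realType) (n l : nat) (m : 'I_l -> nat) (p : R)
    (alpha : 'I_l -> R) (X : 'rV[R]_n) : R :=
  n%:R * (\sum_(q < l) alpha q / n%:R ^+ m q * distinct_sum (m q) X)
  + logit p * l1norm X.

Definition partial_formula (R : realType) (n l : nat) (m : 'I_l -> nat) (p : R)
    (alpha : 'I_l -> R) (j : 'I_n) (X : 'rV[R]_n) : R :=
  2^-1 * logit p
  + \sum_(q < l) (m q)%:R * alpha q / (2 * n%:R ^+ (m q).-1) * C_sum (m q) j X.

(* The two branches agree on {0,1}^n: see partialE below. *)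
Definition partial (R : realType) (n l : nat) (m : 'I_l -> nat) (p : R)
    (alpha : 'I_l -> R) (j : 'I_n) (X : 'rV[R]_n) : R :=
  if is_boolean X then discrete_partial (hamiltonian m p alpha) j X
  else partial_formula m p alpha j X.

Definition gradient (R : realType) (n l : nat) (m : 'I_l -> nat) (p : R)
    (alpha : 'I_l -> R) (X : 'rV[R]_n) : 'rV[R]_n :=
  \row_j partial m p alpha j X.

Definition C_alpha (R : realType) (l : nat) (m : 'I_l -> nat) (p : R)
    (alpha : 'I_l -> R) : R :=
  Num.max 2 (2^-1 * `|logit p|
             + 2^-1 * \sum_(q < l) `|alpha q| * (m q)%:R * (m q).-1%:R).

Definition X_f (R : realType) (n l : nat) (m : 'I_l -> nat) (p : R)
    (alpha : 'I_l -> R) : set 'rV[R]_n :=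
  [set X | in_cube X /\
    l1norm (X - 2^-1 *: (const_mx 1 + map_mx (@tanh R) (gradient m p alpha X)))
      <= 5000 * C_alpha m p alpha ^+ 2 * n%:R `^ (7 / 8)].

Definition phi_alpha (R : realType) (n l : nat) (m : 'I_l -> nat) (p : R)
    (alpha : 'I_l -> R) (x : R) : R :=
  2^-1 * (1 + tanh (2^-1 * logit p
    + 2^-1 * \sum_(q < l) (m q)%:R * alpha q
        * (\prod_(1 <= i < m q) (1 - i%:R / n%:R)) * x ^+ (m q).-1)).

Definition unique_fixed_point (R : realType) (phi : R -> R) (x : R) : Prop :=
  unique (fun y => 0 <= y <= 1 /\ y = phi y) x.

(* To be used when x is the unique fixed point of phi_alpha. The set is then
   bounded since phi_alpha is Lipschitz on [0,1], so that sup is not a junk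
   value. If it is 0 (phi_alpha is constant), then log C_alpha / log D_alpha
   evaluates to 0, which is its limit as D_alpha tends to 0. *)
Definition D_alpha (R : realType) (n l : nat) (m : 'I_l -> nat) (p : R)
    (alpha : 'I_l -> R) (x : R) : R :=
  sup [set `|phi_alpha n m p alpha y - x| / `|y - x|
      | y in [set y : R | 0 <= y <= 1 /\ y <> x]].

Section PartialE.
Variables (R : realType) (n : nat).
Implicit Types (X : 'rV[R]_n) (s : seq 'I_n).

Let avoid_sum s k X : R :=
  \sum_(t : k.-tuple 'I_n | uniq t && ~~ has (mem s) t) \prod_(i <- t) X 0 i.

Let avoid_sumS s k X :
  avoid_sum s k.+1 X = \sum_(i | i \notin s) X 0 i * avoid_sum (i :: s) k X.
Proof.
rewrite /avoid_sum.
under [RHS]eq_bigr => i _ do rewrite big_distrr /=.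
rewrite pair_big_dep /=.
rewrite (reindex (fun u : 'I_n * k.-tuple 'I_n => cons_tuple u.1 u.2)) /=.
  apply: eq_big => [[i t]|[i t] _] /=; last by rewrite big_cons.
  have -> : has (mem (i :: s)) t = (i \in val t) || has (mem s) t.
    rewrite -has_pred1 -has_predU; apply: eq_has => x /=.
    by rewrite inE.
  by rewrite !negb_or; case: (_ \in _); case: (uniq _); case: (_ \in _);
    case: (has _ _).
exists (fun t => (thead t, behead_tuple t)) => [[i t]|t] _ /=.
  by congr (_, _); apply: val_inj.
by rewrite [t in RHS]tuple_eta; apply: val_inj.
Qed.

Let eq_avoid_sum s s' k X : s =i s' -> avoid_sum s k X = avoid_sum s' k X.
Proof.
by move=> es; apply: eq_bigl => t; congr (_ && ~~ _); apply: eq_has => x /=;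
  rewrite es.
Qed.

Let avoid_sum_set s k X j a : j \in s ->
  avoid_sum s k (set_coord X j a) = avoid_sum s k X.
Proof.
move=> js; apply: eq_bigr => t /andP[_ /hasPn tP].
apply: eq_big_seq => i it; rewrite mxE; case: eqP => // ij.
by have := tP i it; rewrite ij /= js.
Qed.

Let avoid_sum_coord s k X j a : j \notin s ->
  avoid_sum s k (set_coord X j a) =
  avoid_sum (j :: s) k X + a * k%:R * avoid_sum (j :: s) k.-1 X.
Proof.
elim: k s => [|k IHk] s js.
  rewrite mulr0 mul0r addr0; apply: eq_big => [t|t _].
    by rewrite [t]tuple0.
  by rewrite [t]tuple0 !big_nil.
rewrite avoid_sumS (bigD1 j) //= mxE eqxx avoid_sum_set ?mem_head//.
have -> : \sum_(i | (i \notin s) && (i != j))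
     set_coord X j a 0 i * avoid_sum (i :: s) k (set_coord X j a) =
   \sum_(i | i \notin j :: s) X 0 i * avoid_sum (i :: j :: s) k X +
   a * k%:R * avoid_sum (j :: s) k X.
  have -> : a * k%:R * avoid_sum (j :: s) k X =
      \sum_(i | i \notin j :: s)
        X 0 i * (a * k%:R * avoid_sum (i :: j :: s) k.-1 X).
    case: k {IHk} => [|k].
      by rewrite mulr0 mul0r big1 // => i _; rewrite mul0r mulr0.
    rewrite avoid_sumS mulr_sumr; apply: eq_bigr => i _.
    by rewrite mulrCA.
  rewrite -big_split /=; apply: eq_big => [i|i /andP[si ij]].
    by rewrite inE negb_or andbC.
  have ji : j \notin i :: s by rewrite inE negb_or eq_sym ij.
  have ijs : [:: j, i & s] =i [:: i, j & s] by move=> x; rewrite !inE orbCA.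
  rewrite mxE (negbTE ij) IHk// -mulrDr.
  by rewrite !(eq_avoid_sum _ _ ijs).
by rewrite -avoid_sumS addrCA -mulrDl -[k.+1]add1n natrD mulrDr mulr1.
Qed.

Lemma distinct_sum_coord k X (j : 'I_n) (a : R) : (0 < k)%N ->
  distinct_sum k (set_coord X j a) =
  distinct_sum k (set_coord X j 0) + a * k%:R * C_sum k j X.
Proof.
move=> k0.
have E b : distinct_sum k (set_coord X j b) = avoid_sum [::] k (set_coord X j b).
  apply: eq_bigl => t; rewrite (@eq_has _ _ pred0) ?has_pred0 ?andbT// => x.
rewrite !E !avoid_sum_coord ?in_nil // !mul0r addr0; congr (_ + _ * _).
apply: eq_bigl => t /=; rewrite andbC; congr (~~ _ && _).
by rewrite -has_pred1; apply: eq_has => x; rewrite /= inE.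
Qed.

Lemma partialE l (m : 'I_l -> nat) (p : R) (alpha : 'I_l -> R) (j : 'I_n) X :
  (forall q, 0 < m q)%N ->
  partial m p alpha j X = partial_formula m p alpha j X.
Proof.
move=> m0; rewrite /partial; case: ifP => // _.
have n0 : n%:R != 0 :> R.
  by rewrite pnatr_eq0 -lt0n; apply: leq_ltn_trans (ltn_ord j).
rewrite /discrete_partial /hamiltonian /partial_formula.
have normE a : 0 <= a -> l1norm (set_coord X j a) =
    a + \sum_(i < n | i != j) `|X 0 i|.
  move=> a0; rewrite /l1norm (bigD1 j)//= mxE eqxx ger0_norm//; congr (_ + _).
  by apply: eq_bigr => i ij; rewrite mxE (negbTE ij).
rewrite !normE // opprD addrACA -mulrBr -mulrBr add0r addrK mulr1 -sumrB.
rewrite [LHS]mulrDr addrC; congr (_ + _).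
rewrite mulrA mulr_sumr; apply: eq_bigr => q _.
rewrite (distinct_sum_coord _ _ 1)// -mulrBr addrAC subrr add0r mul1r.
rewrite -[in n%:R ^+ m q](prednK (m0 q)) exprS.
move: (C_sum _ _ _) ((m q)%:R) (n%:R) n0 => c k N N0.
by field; rewrite expf_neq0 N0.
Qed.

End PartialE.

(* Main.v *)
Require Import Defs.
From mathcomp Require Import all_boot all_order all_algebra.
From mathcomp Require Import all_classical all_reals all_analysis.
From mathcomp Require Import ring lra.
Import Order.TTheory GRing.Theory Num.Theory.
Local Open Scope classical_set_scope.
Local Open Scope ring_scope.
Set Implicit Arguments.
Unset Strict Implicit.
Unset Printing Implicit Defensive.

(** Write Phi(X) = (1 + tanh (grad f X)) / 2, so that X_f consists of the points
of the cube [0,1]^n which Phi moves by at most B = 5000 C_alpha^2 n^(7/8) in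
1-norm. Four properties of Phi carry the proof.
- Phi is C_alpha-Lipschitz in 1-norm on the cube
  ([mean_field_map_lipschitz]): each partial derivative is a polynomial with
  coefficients of the right order in n, and tanh is 1-Lipschitz.
- Phi is monotone for the entrywise order ([mean_field_map_mono]), because the
  couplings alpha_q are nonnegative and tanh increases.
- On the diagonal, Phi acts as the scalar map phi_alpha
  ([mean_field_map_const]): counting tuples of distinct indices produces
  exactly the factors 1 - i/n.
- By definition of D_alpha as a supremum of slopes, phi_alpha contracts
  distances to its fixed point x by D_alpha ([slope_le_D_alpha]).

Iterate Phi. On one hand, the Lipschitz property makes k iterations move X by
at most B (1 + C_alpha + ... + C_alpha^(k-1)) ([l1norm_sub_iter]). On the
other hand X lies between the constant vectors 0 and 1, so by monotonicity
Phi^k(X) lies between two constant vectors whose entries phi_alpha^k(0) and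
phi_alpha^k(1) are both within D_alpha^k of x; hence Phi^k(X) is within
n D_alpha^k of the constant vector x ([l1norm_iter_sub]). Thus
the contraction of phi_alpha on the diagonal controls the whole cube, although
the Lipschitz constant of Phi there may exceed 1.

Taking for k the first integer larger than log eps / log D_alpha makes the
second error at most eps n, and since C_alpha >= 2 the geometric sum is at most
2 C_alpha^(k-1) <= 2 eps^(log C_alpha / log D_alpha) ([iteration_count]). This
is the first bound. The second one follows with eps = n^(-eta), for eta so
small that the loss eps^(log C_alpha / log D_alpha) does not consume the
factor n^(1/8) by which n^(7/8) is smaller than n. *)

(** * The hyperbolic tangent *)

Section Tanh.
Variable R : realType.
Implicit Types u v : R.

Lemma is_derive_tanh u :
  is_derive u (1 : R) (@tanh R) (4 / (expR u + expR (- u)) ^+ 2).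
Proof.
have e0 : expR u + expR (- u) != 0 by rewrite gt_eqF// addr_gt0 ?expR_gt0.
have := is_derive1_comp (is_derive_expR (- u)) (is_deriveNid u 1).
rewrite mulrN1 => dN.
have e1 : expR u * expR (- u) = 1 by rewrite expRxMexpNx_1.
have dV := @is_deriveV R (fun z : R => expR z + expR (- z)) u _ 1 e0
  (is_deriveD (is_derive_expR u) dN).
have H := is_deriveM (is_deriveB (is_derive_expR u) dN) dV.
apply: (is_derive_eq H).
rewrite /GRing.scale /=.
have -> : (expR - (expR \o -%R)) u = expR u - expR (- u) by [].
(* The identity (a + b)^2 - (a - b)^2 = 4 a b with a b = 1. *)
have -> : 4 = 4 * (expR u * expR (- u)) by rewrite e1 mulr1.
by field.
Qed.

(** The mean value theorem: the derivative 4 / (e^z + e^-z)^2 is positive, and at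
most 1 by the inequality between arithmetic and geometric means. Monotonicity
and the Lipschitz bound both follow from this. *)
Lemma tanh_increment u v : u <= v ->
  exists2 c, 0 <= c <= 1 & tanh v - tanh u = c * (v - u).
Proof.
move=> uv.
have [|z _ ->] := MVT_segment uv (fun z _ => is_derive_tanh z).
  by apply: derivable_within_continuous => z _; case: (is_derive_tanh z).
exists (4 / (expR z + expR (- z)) ^+ 2) => //.
have z0 := expR_gt0 z; have Nz0 := expR_gt0 (- z).
have e1 : expR z * expR (- z) = 1 by rewrite expRxMexpNx_1.
have s0 : 0 < (expR z + expR (- z)) ^+ 2 by rewrite exprn_gt0// addr_gt0.
apply/andP; split; first by rewrite divr_ge0// ltW.
rewrite ler_pdivrMr// mul1r.
have := sqr_ge0 (expR z - expR (- z)); nra.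
Qed.

Lemma le_tanh : {homo @tanh R : u v / u <= v}.
Proof.
move=> u v uv; have [c /andP[c0 _] E] := tanh_increment uv.
by rewrite -subr_ge0 E mulr_ge0// subr_ge0.
Qed.

Lemma tanh_lipschitz u v : `|tanh u - tanh v| <= `|u - v|.
Proof.
wlog uv : u v / u <= v => [H|].
  by have /orP[/H//|/H] := le_total u v; rewrite distrC [leRHS]distrC.
rewrite distrC [leRHS]distrC; have [c /andP[c0 c1] ->] := tanh_increment uv.
by rewrite normrM ger0_norm// ler_piMl.
Qed.

Lemma tanh_itv u : -1 <= tanh u <= 1.
Proof.
have z0 := expR_gt0 u; have Nz0 := expR_gt0 (- u).
by rewrite /tanh ler_pdivlMr ?addr_gt0// ler_pdivrMr ?addr_gt0//; lra.
Qed.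

End Tanh.

(** * Sums over tuples *)

Section TupleSums.
Variables (R : realType) (T : finType).

Lemma sum_tupleS k (F : k.+1.-tuple T -> R) :
  \sum_(t : k.+1.-tuple T) F t =
  \sum_(i : T) \sum_(t : k.-tuple T) F (cons_tuple i t).
Proof.
rewrite pair_big /= (reindex (fun u : T * k.-tuple T => cons_tuple u.1 u.2)) //=.
exists (fun t => (thead t, behead_tuple t)) => [[i t]|t] _ /=.
  by congr (_, _); apply: val_inj.
by rewrite [t in RHS]tuple_eta; apply: val_inj.
Qed.

(** Each of the k positions contributes #|T|^(k-1) times the sum of d. Multiplying
by #|T| avoids the exponent k - 1, which misbehaves at k = 0. *)
Lemma sum_tuple_sum k (d : T -> R) :
  #|T|%:R * \sum_(t : k.-tuple T) \sum_(i <- t) d i =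
  k%:R * #|T|%:R ^+ k * \sum_i d i.
Proof.
elim: k => [|k IHk].
  by rewrite !mul0r big1 ?mulr0// => t _; rewrite [t]tuple0 big_nil.
rewrite sum_tupleS.
under eq_bigr => i _ do
  under eq_bigr => t _ do rewrite big_cons.
under eq_bigr => i _ do rewrite big_split /= sumr_const card_tuple -mulr_natl.
rewrite big_split /= -mulr_sumr sumr_const -[X in _ * (_ + X)]mulr_natl.
rewrite mulrDr IHk natrX.
by rewrite exprS mulrSr; ring.
Qed.

(** Changing the factors one at a time costs at most the change of each, since the
other factors lie in [0,1]. *)
Lemma prod_lipschitz (I : Type) (s : seq I) (a b : I -> R) :
  (forall i, 0 <= a i <= 1) -> (forall i, 0 <= b i <= 1) ->
  `|\prod_(i <- s) a i - \prod_(i <- s) b i| <= \sum_(i <- s) `|a i - b i|.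
Proof.
move=> a01 b01; elim: s => [|i s IHs]; first by rewrite !big_nil subrr normr0.
rewrite !big_cons.
have -> (p q : R) : a i * p - b i * q = (a i - b i) * p + b i * (p - q) by ring.
apply: le_trans (ler_normD _ _) _; rewrite !normrM lerD//.
  rewrite ler_piMr//; have : 0 <= \prod_(j <- s) a j <= 1.
    apply/andP; split; first by apply: prodr_ge0 => j _; case/andP: (a01 j).
    by apply: prodr_ile1 => j _; exact: a01.
  by case/andP=> p0 p1; rewrite ger0_norm.
apply: le_trans IHs; case/andP: (b01 i) => b0 b1.
by rewrite ler_piMl// ger0_norm.
Qed.

End TupleSums.

(** * The elementary sums in the gradient *)

Section CSum.
Variables (R : realType) (n : nat).
Implicit Types (X Y : 'rV[R]_n) (j : 'I_n).

Lemma le_C_sum k j X Y : (forall i, 0 <= X 0 i <= Y 0 i) ->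
  C_sum k j X <= C_sum k j Y.
Proof. by move=> XY; apply: ler_sum => t _; apply: ler_prod => i _. Qed.

(** The sum over distinct indices is bounded by the one over all tuples, to which
[sum_tuple_sum] applies. *)
Lemma C_sum_lipschitz k j X Y : in_cube X -> in_cube Y ->
  n%:R * `|C_sum k j X - C_sum k j Y| <=
  k.-1%:R * n%:R ^+ k.-1 * l1norm (X - Y).
Proof.
move=> X01 Y01; rewrite -[n in n%:R ^+ _]card_ord.
have -> : l1norm (X - Y) = \sum_i `|X 0 i - Y 0 i|.
  by apply: eq_bigr => i _; rewrite !mxE.
rewrite -sum_tuple_sum card_ord ler_wpM2l// -sumrB.
apply: le_trans (ler_norm_sum _ _ _) _.
apply: le_trans (_ : \sum_(t : k.-1.-tuple 'I_n | uniq (j :: t))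
    \sum_(i <- t) `|X 0 i - Y 0 i| <= _).
  by apply: ler_sum => t _; apply: prod_lipschitz.
rewrite [leRHS](bigID (fun t : k.-1.-tuple 'I_n => uniq (j :: t))) /= lerDl.
by apply: sumr_ge0 => t _; apply: sumr_ge0.
Qed.

(** All products equal y^(k-1), and the tuples that are injective and avoid j are
counted by a falling factorial. *)
Lemma C_sum_const k j (y : R) :
  C_sum k j (const_mx y) = (n.-1 ^_ k.-1)%:R * y ^+ k.-1.
Proof.
rewrite /C_sum.
under eq_bigr => t _.
  under eq_bigr do rewrite mxE.
  rewrite big_const_seq count_predT size_tuple iter_mulr_1.
  over.
rewrite sumr_const -[LHS]mulr_natl; congr (_%:R * _).
have -> : n.-1 = #|predC1 j| by rewrite cardC1 card_ord.
rewrite -card_uniq_tuples cardsE; apply: eq_card => t; rewrite !unfold_in /=.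
congr (_ && _).
have -> : mem_seq t j = has (pred1 j) t by rewrite has_pred1.
by rewrite -all_predC.
Qed.

(** This also holds for k >= n: both sides vanish, the right one through its factor
of index i = n. *)
Lemma ffact_ratio k : (0 < n)%N ->
  (n.-1 ^_ k)%:R / n%:R ^+ k = \prod_(1 <= i < k.+1) (1 - i%:R / n%:R) :> R.
Proof.
move=> n0; have nR : n%:R != 0 :> R by rewrite pnatr_eq0 -lt0n.
elim: k => [|k IHk]; first by rewrite ffactn0 big_geq// expr0 divr1.
rewrite big_nat_recr//= -IHk ffactnSr exprSr natrM.
have [kn|nk] := leqP k n.-1; last by rewrite ffact_small// !mul0r.
rewrite natrB// -subn1 natrB// -[k.+1]addn1 natrD.
by field; rewrite expf_neq0 nR.
Qed.

End CSum.

(** * The 1-norm *)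

Section L1Norm.
Variables (R : realType) (n : nat).
Implicit Types X Y Z : 'rV[R]_n.

Lemma l1norm_ge0 X : 0 <= l1norm X.
Proof. exact: sumr_ge0. Qed.

Lemma l1norm_triangle Y X Z : l1norm (X - Z) <= l1norm (X - Y) + l1norm (Y - Z).
Proof.
rewrite /l1norm -big_split /=; apply: ler_sum => i _.
by rewrite !mxE; exact: ler_distD.
Qed.

Lemma l1norm_le_const X (a : R) : (forall i, `|X 0 i| <= a) ->
  l1norm X <= a * n%:R.
Proof.
move=> Xa; apply: le_trans (ler_sum _ (fun i _ => Xa i)) _.
by rewrite sumr_const card_ord mulr_natr.
Qed.

Lemma l1norm_const_mx (a : R) : l1norm (const_mx a : 'rV[R]_n) = n%:R * `|a|.
Proof.
rewrite /l1norm; under eq_bigr do rewrite mxE.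
by rewrite sumr_const card_ord mulr_natl.
Qed.

Lemma in_cube_const (a : R) : 0 <= a <= 1 -> in_cube (const_mx a : 'rV[R]_n).
Proof. by move=> a01 i; rewrite mxE. Qed.

End L1Norm.

(** * Iterating a monotone Lipschitz map of the cube *)

Section Iteration.
Variables (R : realType) (n : nat) (Phi : 'rV[R]_n -> 'rV[R]_n).
Implicit Types X Y : 'rV[R]_n.
Hypothesis Phi_cube : forall X, in_cube X -> in_cube (Phi X).

Lemma iter_in_cube k X : in_cube X -> in_cube (iter k Phi X).
Proof. by move=> X01; elim: k => //= k; exact: Phi_cube. Qed.

Section Lipschitz.
Variable C : R.
Hypothesis C0 : 0 <= C.
Hypothesis Phi_lip : forall X Y, in_cube X -> in_cube Y ->
  l1norm (Phi X - Phi Y) <= C * l1norm (X - Y).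

Lemma iter_lipschitz k X Y : in_cube X -> in_cube Y ->
  l1norm (iter k Phi X - iter k Phi Y) <= C ^+ k * l1norm (X - Y).
Proof.
move=> X01 Y01; elim: k => [|k IHk]; first by rewrite expr0 mul1r.
rewrite !iterS; apply: le_trans (Phi_lip _ _) _; try exact: iter_in_cube.
by rewrite exprS -mulrA ler_wpM2l.
Qed.

(** Telescoping: the step from iterate j to iterate j + 1 is the image under the
j-th iterate of the step from X to Phi X. *)
Lemma l1norm_sub_iter k X : in_cube X ->
  l1norm (X - iter k Phi X) <= l1norm (X - Phi X) * \sum_(j < k) C ^+ j.
Proof.
move=> X01; elim: k => [|k IHk].
  by rewrite big_ord0 mulr0 /= subrr /l1norm big1// => i _; rewrite mxE normr0.
apply: le_trans (l1norm_triangle (iter k Phi X) _ _) _.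
rewrite big_ord_recr /= mulrDr lerD// -iterS iterSr [leRHS]mulrC.
by apply: iter_lipschitz => //; exact: Phi_cube.
Qed.

End Lipschitz.

Section Monotone.
Variables (phi : R -> R) (x D : R).
Hypothesis Phi_mono : forall X Y, in_cube X -> in_cube Y ->
  (forall i, X 0 i <= Y 0 i) -> forall i, Phi X 0 i <= Phi Y 0 i.
Hypothesis Phi_const : forall y, 0 <= y <= 1 ->
  Phi (const_mx y) = const_mx (phi y).
Hypothesis phi_itv : forall y, 0 <= y <= 1 -> 0 <= phi y <= 1.
Hypothesis phi_contr : forall y, 0 <= y <= 1 -> `|phi y - x| <= D * `|y - x|.
Hypothesis D0 : 0 <= D.
Hypothesis x01 : 0 <= x <= 1.

Lemma iter_const k y : 0 <= y <= 1 ->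
  [/\ iter k Phi (const_mx y) = const_mx (iter k phi y),
      0 <= iter k phi y <= 1 &
      `|iter k phi y - x| <= D ^+ k].
Proof.
move=> y01; elim: k => [|k [E I H]] /=.
  split=> //; case/andP: x01 => ? ?; case/andP: y01 => ? ?.
  by rewrite expr0 ler_norml; lra.
split; [by rewrite E Phi_const|exact: phi_itv|].
by apply: le_trans (phi_contr I) _; rewrite exprS ler_wpM2l.
Qed.

Lemma iter_mono k X Y : in_cube X -> in_cube Y ->
  (forall i, X 0 i <= Y 0 i) -> forall i, iter k Phi X 0 i <= iter k Phi Y 0 i.
Proof.
move=> X01 Y01 XY; elim: k => //= k IHk.
by apply: Phi_mono => //; exact: iter_in_cube.
Qed.

(** The iterates of X are squeezed between those of the constant vectors 0 and 1,
which stay on the diagonal and converge geometrically there. *)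
Lemma l1norm_iter_sub k X : in_cube X ->
  l1norm (iter k Phi X - const_mx x) <= D ^+ k * n%:R.
Proof.
move=> X01; apply: l1norm_le_const => i.
have z01 : 0 <= (0 : R) <= 1 by rewrite lexx ler01.
have o01 : 0 <= (1 : R) <= 1 by rewrite lexx ler01.
have [E0 _ H0] := iter_const k z01; have [E1 _ H1] := iter_const k o01.
have lo := @iter_mono k (const_mx 0) X (in_cube_const z01) X01
  (fun i => ltac:(by rewrite mxE; case/andP: (X01 i))) i.
have hi := @iter_mono k X (const_mx 1) X01 (in_cube_const o01)
  (fun i => ltac:(by rewrite mxE; case/andP: (X01 i))) i.
rewrite E0 mxE in lo; rewrite E1 mxE in hi.
by rewrite !mxE; move: H0 H1; rewrite !ler_norml; lra.
Qed.

End Monotone.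
End Iteration.

(** * The mean-field map *)

Section MeanField.
Variables (R : realType) (n l : nat) (m : 'I_l -> nat) (p : R).
Variable alpha : 'I_l -> R.
Implicit Types X Y : 'rV[R]_n.
Hypothesis n_gt0 : (0 < n)%N.
Hypothesis m_gt0 : forall q, (0 < m q)%N.

Let nR : 0 < n%:R :> R. Proof. by rewrite ltr0n. Qed.

(** The map whose approximate fixed points form X_f. *)
Definition mean_field_map X : 'rV[R]_n :=
  2^-1 *: (const_mx 1 + map_mx (@tanh R) (gradient m p alpha X)).

Local Notation Phi := mean_field_map.

Lemma mean_field_mapE X j :
  Phi X 0 j = 2^-1 * (1 + tanh (partial_formula m p alpha j X)).
Proof. by rewrite !mxE partialE. Qed.

Lemma mean_field_map_cube X : in_cube (Phi X).
Proof.
move=> j; rewrite mean_field_mapE.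
by case/andP: (tanh_itv (partial_formula m p alpha j X)); lra.
Qed.

Lemma mean_field_map_mono : (forall q, 0 <= alpha q) ->
  forall X Y, in_cube X -> (forall i, X 0 i <= Y 0 i) ->
  forall j, Phi X 0 j <= Phi Y 0 j.
Proof.
move=> a0 X Y X01 XY j; rewrite !mean_field_mapE ler_pM2l ?invr_gt0// lerD2l.
apply: le_tanh; rewrite lerD2l; apply: ler_sum => q _.
apply: ler_wpM2l.
  by rewrite divr_ge0 ?mulr_ge0// exprn_ge0.
by apply: le_C_sum => i; rewrite XY andbT; case/andP: (X01 i).
Qed.

(** By [C_sum_lipschitz], the powers of n in the coefficients leave exactly one
factor 1/n, which summation over the n coordinates j will absorb. *)
Lemma partial_formula_lipschitz j X Y : in_cube X -> in_cube Y ->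
  n%:R * `|partial_formula m p alpha j X - partial_formula m p alpha j Y| <=
  2^-1 * (\sum_(q < l) `|alpha q| * (m q)%:R * (m q).-1%:R) * l1norm (X - Y).
Proof.
move=> X01 Y01; rewrite /partial_formula opprD addrACA subrr add0r -sumrB.
apply: le_trans (ler_wpM2l (ltW nR) (ler_norm_sum _ _ _)) _.
rewrite mulr_sumr [2^-1 * _]mulr_sumr mulr_suml; apply: ler_sum => q _.
have N0 : 0 < n%:R ^+ (m q).-1 :> R by rewrite exprn_gt0.
rewrite -mulrBr normrM mulrCA normrM normfV normrM (gtr0_norm (mulr_gt0 _ N0))//.
rewrite (ger0_norm (ler0n _ _)).
apply: le_trans (ler_wpM2l _ (C_sum_lipschitz (m q) j X01 Y01)) _.
  by rewrite divr_ge0 ?mulr_ge0// ltW.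
rewrite le_eqVlt; apply/orP; left; apply/eqP; field; rewrite gt_eqF//.
Qed.

Lemma C_alpha_ge2 : 2 <= C_alpha m p alpha.
Proof. by rewrite le_max lexx. Qed.

Lemma mean_field_map_lipschitz X Y : in_cube X -> in_cube Y ->
  l1norm (Phi X - Phi Y) <= C_alpha m p alpha * l1norm (X - Y).
Proof.
move=> X01 Y01; set L := 2^-1 * (\sum_(q < l) `|alpha q| * (m q)%:R * (m q).-1%:R).
have L_le : L <= C_alpha m p alpha.
  by rewrite le_max lerDr mulr_ge0 ?invr_ge0// orbT.
apply: le_trans (ler_wpM2r (l1norm_ge0 _) L_le).
have -> : L * l1norm (X - Y) = L * l1norm (X - Y) / n%:R * n%:R.
  by rewrite divfK// gt_eqF.
apply: l1norm_le_const => j; rewrite ler_pdivlMr// mulrC.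
apply: le_trans (partial_formula_lipschitz j X01 Y01); rewrite ler_wpM2l//.
rewrite mxE [(- Phi Y) 0 j]mxE !mean_field_mapE -mulrBr opprD addrACA subrr add0r.
rewrite normrM.
rewrite ger0_norm ?invr_ge0//.
apply: le_trans (tanh_lipschitz _ _).
by rewrite ler_piMl// invf_le1// ler1n.
Qed.

Lemma mean_field_map_const y :
  Phi (const_mx y) = const_mx (phi_alpha n m p alpha y).
Proof.
apply/rowP => j; rewrite mean_field_mapE mxE /phi_alpha /partial_formula.
congr (_ * (_ + tanh (_ + _))); rewrite mulr_sumr; apply: eq_bigr => q _.
have := ffact_ratio R (m q).-1 n_gt0; rewrite prednK// => <-.
rewrite C_sum_const.
by field; rewrite expf_neq0// gt_eqF.
Qed.

Lemma phi_alpha_itv y : 0 <= phi_alpha n m p alpha y <= 1.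
Proof.
have := mean_field_map_cube (const_mx y) (Ordinal n_gt0).
by rewrite mean_field_map_const mxE.
Qed.

(** The Lipschitz bound for Phi, restricted to constant vectors. *)
Lemma phi_alpha_lipschitz y z : 0 <= y <= 1 -> 0 <= z <= 1 ->
  `|phi_alpha n m p alpha y - phi_alpha n m p alpha z| <=
  C_alpha m p alpha * `|y - z|.
Proof.
move=> y01 z01.
have := mean_field_map_lipschitz (in_cube_const y01) (in_cube_const z01).
have constB (a b : R) : const_mx a - const_mx b = const_mx (a - b) :> 'rV[R]_n.
  by apply/rowP => i; rewrite !mxE.
by rewrite !mean_field_map_const !constB !l1norm_const_mx mulrCA ler_pM2l.
Qed.

Section FixedPoint.
Variable x : R.
Hypothesis x01 : 0 <= x <= 1.
Hypothesis x_fix : x = phi_alpha n m p alpha x.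

(** Without this bound the supremum defining D_alpha would carry no information. *)
Lemma slope_has_ubound : has_ubound
  [set `|phi_alpha n m p alpha y - x| / `|y - x|
    | y in [set y : R | 0 <= y <= 1 /\ y <> x]].
Proof.
exists (C_alpha m p alpha) => _ [y [y01 /eqP yx] <-].
by rewrite ler_pdivrMr ?normr_gt0 ?subr_eq0// {1}x_fix phi_alpha_lipschitz.
Qed.

Lemma slope_le_D_alpha y : 0 <= y <= 1 ->
  `|phi_alpha n m p alpha y - x| <= D_alpha n m p alpha x * `|y - x|.
Proof.
move=> y01; have [->|yx] := eqVneq y x.
  by rewrite -x_fix subrr normr0 mulr0.
rewrite -ler_pdivrMr ?normr_gt0 ?subr_eq0//.
by apply: (ub_le_sup slope_has_ubound); exists y => //; split=> //; exact/eqP.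
Qed.

Lemma D_alpha_ge0 : 0 <= D_alpha n m p alpha x.
Proof.
have [y y01 yx] : exists2 y, 0 <= y <= 1 & y != x.
  have [->|x0] := eqVneq x 0.
    by exists 1; rewrite ?oner_eq0// ler01 lexx.
  by exists 0; rewrite 1?eq_sym// ler01 lexx.
have d0 : 0 < `|y - x| by rewrite normr_gt0 subr_eq0.
by rewrite -(pmulr_lge0 _ d0) (le_trans _ (slope_le_D_alpha y01)).
Qed.

Lemma X_f_iter_bound k X : (forall q, 0 <= alpha q) -> X_f m p alpha X ->
  l1norm (X - const_mx x) <=
    D_alpha n m p alpha x ^+ k * n%:R
    + 5000 * C_alpha m p alpha ^+ 2 * n%:R `^ (7 / 8)
      * \sum_(j < k) C_alpha m p alpha ^+ j.
Proof.
move=> a0 [X01 XB]; rewrite [leRHS]addrC.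
have C0 : 0 <= C_alpha m p alpha by apply: le_trans C_alpha_ge2.
apply: le_trans (l1norm_triangle (iter k Phi X) _ _) _; apply: lerD.
  apply: le_trans (l1norm_sub_iter _ C0 _ k X01) _.
  - by move=> Y _; exact: mean_field_map_cube.
  - exact: mean_field_map_lipschitz.
  - by apply: ler_wpM2r XB; apply: sumr_ge0 => j _; exact: exprn_ge0.
apply: (@l1norm_iter_sub _ _ _ _ (phi_alpha n m p alpha)) => //.
- by move=> Y _; exact: mean_field_map_cube.
- by move=> Y Z Y01 _; exact: mean_field_map_mono.
- by move=> y _; exact: mean_field_map_const.
- by move=> y _; exact: phi_alpha_itv.
- exact: slope_le_D_alpha.
- exact: D_alpha_ge0.
Qed.

End FixedPoint.
End MeanField.

(** * The number of iterations *)

Section Optimisation.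
Variable R : realType.
Implicit Types C D eps : R.

Lemma sum_geometric_le C k : 2 <= C -> \sum_(j < k.+1) C ^+ j <= 2 * C ^+ k.
Proof.
move=> C2; elim: k => [|k IHk]; first by rewrite big_ord1 expr0; lra.
rewrite big_ord_recr /= mulr_natl mulr2n lerD2r; apply: le_trans IHk _.
by rewrite exprS ler_wpM2r// exprn_ge0//; lra.
Qed.

(** For D > 0, take k = floor t + 1 with t = ln eps / ln D: then D^k <= D^t = eps,
while C^(k-1) <= C^t = eps^(ln C / ln D). For D = 0 one iteration suffices, and
the exponent, a division by ln 0 = 0, is 0. *)
Lemma iteration_count C D eps : 2 <= C -> 0 <= D < 1 -> 0 < eps < 1 ->
  exists k, D ^+ k <= eps /\
    \sum_(j < k) C ^+ j <= 2 * eps `^ (ln C / ln D).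
Proof.
move=> C2 /andP[D0 D1] /andP[e0 e1].
have C0 : 0 < C by lra.
have [->|Dn0] := eqVneq D 0.
  exists 1%N; rewrite expr1 big_ord1 expr0 [ln 0]ln0// invr0 mulr0 powRr0.
  by split; [exact: ltW|lra].
have Dpos : 0 < D by rewrite lt_neqAle eq_sym Dn0.
have lnD : ln D < 0 by rewrite ln_lt0// Dpos.
have lne : ln eps < 0 by rewrite ln_lt0// e0.
pose t := ln eps / ln D.
have t0 : 0 <= t by rewrite /t -mulrNN -invrN divr_ge0// oppr_ge0 ltW.
have tD : t * ln D = ln eps by rewrite /t divfK// lt_eqF.
have /andP[kt tk] := truncn_itv t0; set k := Num.trunc t in kt tk *.
exists k.+1; split.
  rewrite -powR_mulrn// -[leRHS]lnK// /powR gt_eqF// ler_expR -tD.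
  by rewrite ler_wnM2r// ltW.
apply: le_trans (sum_geometric_le k C2) _; rewrite ler_pM2l//.
rewrite -(powR_mulrn _ (ltW C0)) /powR (gt_eqF C0) (gt_eqF e0) ler_expR -tD.
rewrite [t * _]mulrC mulrA divfK ?lt_eqF// [leRHS]mulrC ler_wpM2r// ln_ge0//.
by lra.
Qed.

End Optimisation.

(** * Distance from near-fixed points to the constant vector *)

Section Distance.
Variables (R : realType) (n l : nat) (m : 'I_l -> nat) (p : R).
Variables (alpha : 'I_l -> R) (x : R).
Hypothesis n_gt0 : (0 < n)%N.
Hypothesis m_gt0 : forall q, (0 < m q)%N.
Hypothesis alpha_ge0 : forall q, 0 <= alpha q.
Hypothesis x01 : 0 <= x <= 1.
Hypothesis x_fix : x = phi_alpha n m p alpha x.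
Hypothesis D_lt1 : D_alpha n m p alpha x < 1.

Local Notation C := (C_alpha m p alpha).
Local Notation D := (D_alpha n m p alpha x).

Lemma X_f_eps_bound (X : 'rV[R]_n) (eps : R) :
  X_f m p alpha X -> 0 < eps < 1 ->
  l1norm (X - const_mx x) <=
    eps * n%:R + 10000 * C ^+ 2 * eps `^ (ln C / ln D) * n%:R `^ (7 / 8).
Proof.
move=> XX e01.
have D01 : 0 <= D < 1 by rewrite D_lt1 D_alpha_ge0.
have [k [Dk Ck]] := iteration_count (C_alpha_ge2 m p alpha) D01 e01.
apply: le_trans (X_f_iter_bound n_gt0 m_gt0 x01 x_fix k alpha_ge0 XX) _.
apply: lerD; first by rewrite ler_wpM2r.
set P := n%:R `^ _; set E := eps `^ _ in Ck *.
have K0 : 0 <= 5000 * C ^+ 2 * P.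
  by apply: mulr_ge0; [rewrite mulr_ge0 ?ler0n ?sqr_ge0|exact: powR_ge0].
have -> : 10000 * C ^+ 2 * E * P = 5000 * C ^+ 2 * P * (2 * E) by ring.
exact: ler_wpM2l.
Qed.

(** The choice eps = n^(-eta) in [X_f_eps_bound]; the condition on eta says that
7/8 + eta |a| <= 1 - eta for the exponent a = ln C / ln D. When n = 1 this eps
is 1, outside the admissible range, but then the distance is at most n = 1. *)
Lemma X_f_power_bound (X : 'rV[R]_n) (eta : R) :
  X_f m p alpha X -> 0 < eta -> eta * (1 + `|ln C / ln D|) <= 1 / 8 ->
  l1norm (X - const_mx x) <= (1 + 10000 * C ^+ 2) * n%:R `^ (1 - eta).
Proof.
move=> XX eta0 eta_le.
have C2 : 0 <= 10000 * C ^+ 2 by rewrite mulr_ge0 ?ler0n ?sqr_ge0.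
have [n1|n1] := leqP n 1.
  have -> : (n%:R : R) `^ (1 - eta) = n%:R :> R.
    have -> : n = 1%N by apply/eqP; rewrite eqn_leq n1 n_gt0.
    by rewrite powR1.
  case: XX => X01 _; apply: l1norm_le_const => i; rewrite !mxE ler_norml.
  move: C2; move: (10000 * C ^+ 2) => K K0.
  by case/andP: (X01 i) => ? ?; case/andP: x01 => ? ?; lra.
have N1 : 1 < n%:R :> R by rewrite ltr1n.
have N0 : 0 < n%:R :> R by rewrite ltr0n.
have nN0 : (n%:R == 0 :> R) = false by rewrite gt_eqF.
have e01 : 0 < (n%:R : R) `^ (- eta) < 1.
  apply/andP; split; first exact: powR_gt0.
  rewrite /powR nN0 -[ltRHS]expR0 ltr_expR mulNr oppr_lt0.
  by apply: mulr_gt0 => //; exact: ln_gt0.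
apply: le_trans (X_f_eps_bound XX e01) _.
move: (10000 * C ^+ 2) C2 => K K0; rewrite [leRHS]mulrDl mul1r.
apply: lerD.
  rewrite -[X in _ * X](powRr1 (ltW N0)) -powRD ?nN0 ?implybT//.
  by rewrite addrC.
rewrite -mulrA; apply: ler_wpM2l => //.
rewrite -powRrM -powRD ?nN0 ?implybT//; apply: (ler_powR (ltW N1)).
set a := ln C / ln D in eta_le *.
have : - a <= `|a| by rewrite -normrN ler_norm.
by move: (`|a|) eta_le => b; nra.
Qed.

End Distance.

Theorem theorem4p7 (R : realType) :
  (forall (n l : nat) (m : 'I_l -> nat) (p : R) (alpha : 'I_l -> R) (x : R),
     (1 <= n)%N -> (1 <= l)%N ->
     (forall q, 2 <= m q)%N -> injective m ->
     0 < p < 1 -> (forall q, 0 <= alpha q) ->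
     unique_fixed_point (phi_alpha n m p alpha) x ->
     D_alpha n m p alpha x < 1 ->
     forall (X : 'rV[R]_n) (eps : R),
       X_f m p alpha X -> 0 < eps < 1 ->
       l1norm (X - const_mx x) <=
         eps * n%:R
         + 10000 * C_alpha m p alpha ^+ 2
           * eps `^ (ln (C_alpha m p alpha) / ln (D_alpha n m p alpha x))
           * n%:R `^ (7 / 8))
  /\
  (forall C D : R,
     exists c eta : R, [/\ 0 < c, 0 < eta, eta < 1 / 8 &
       forall (n l : nat) (m : 'I_l -> nat) (p : R) (alpha : 'I_l -> R) (x : R),
         (1 <= n)%N -> (1 <= l)%N ->
         (forall q, 2 <= m q)%N -> injective m ->
         0 < p < 1 -> (forall q, 0 <= alpha q) ->
         unique_fixed_point (phi_alpha n m p alpha) x ->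
         D_alpha n m p alpha x < 1 ->
         C_alpha m p alpha = C -> D_alpha n m p alpha x = D ->
         forall X : 'rV[R]_n, X_f m p alpha X ->
           l1norm (X - const_mx x) <= c * n%:R `^ (1 - eta)]).
Proof.
split=> [n l m p alpha x n0 _ m2 _ _ a0 [[x01 xfix] _] D1 X eps XX e01|C D].
  by apply: X_f_eps_bound => // q; exact: ltnW.
pose b := `|ln C / ln D|; have b0 : 0 <= b := normr_ge0 _.
(* The largest admissible eta is 1 / (8 (1 + b)), which is 1/8 when b = 0; halving
   it gives the strict inequality. *)
exists (1 + 10000 * C ^+ 2), (16 * (1 + b))^-1.
have B0 : 0 < 16 * (1 + b) by lra.
have eta0 : 0 < (16 * (1 + b))^-1 by rewrite invr_gt0.
have etaB : (16 * (1 + b))^-1 * (1 + b) = 1 / 16 by field; lra.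
split; [|exact: eta0|by nra|].
  by apply: ltr_pwDl; [exact: ltr01|rewrite mulr_ge0 ?ler0n ?sqr_ge0].
move=> n l m p alpha x n0 _ m2 _ _ a0 [[x01 xfix] _] D1 EC ED X XX.
rewrite -EC; apply: X_f_power_bound => // [q|]; first exact: ltnW.
by rewrite EC ED etaB; lra.
Qed.
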